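(* Let $n\ge 1$ be an integer and let $F\in\mathbb{R}[x_1,\ldots,x_n]$ be a (nonzero) polynomial of degree $d$. Let $s$ be an integer with $s\ge d$. Let $\mathcal{A}\subseteq\mathbb{R}^n$ be an $s$-distance set such that $F$ vanishes on $\mathcal{A}$. Then $$|\mathcal{A}|\leq \binom{n+s}{n}-\binom{n+s-d}{n}.$$
   Context: For $\mathcal{A}\subseteq\mathbb{R}^n$, let $d(\mathcal{A})=\{d(p_1,p_2): p_1,p_2\in\mathcal{A},\ p_1\neq p_2\}$ be the set of non-zero Euclidean distances among points of $\mathcal{A}$. The set $\mathcal{A}$ is an $s$-distance set if $|d(\mathcal{A})|\le s$. Degree means total degree. *)

(* Defs.v *)
From HB Require Import structures.
From mathcomp Require Import all_boot all_order all_algebra.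
From mathcomp Require Import boolp classical_sets functions cardinality reals.
From mathcomp Require Import mpoly.

Set Implicit Arguments.
Unset Strict Implicit.
Unset Printing Implicit Defensive.

Import Order.TTheory GRing.Theory Num.Theory.

Local Open Scope classical_set_scope.
Local Open Scope ring_scope.

(* The norm that MathComp-Analysis puts on ['rV[R]_n] is the max norm, so the
   Euclidean distance is spelled out. *)
Definition edist (R : realType) (n : nat) (p q : 'rV[R]_n) : R :=
  Num.sqrt (\sum_(i < n) (p ord0 i - q ord0 i) ^+ 2).

Definition distances (R : realType) (n : nat) (A : set 'rV[R]_n) : set R :=
  [set r | exists p q : 'rV[R]_n, [/\ A p, A q, p <> q & r = edist p q]].

(* [X #<= `I_k] (there is an injection from X to {0, ..., k-1}) says that X is
   finite with at most k elements; no finiteness of A is presupposed. *)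
Definition s_distance_set (R : realType) (n s : nat) (A : set 'rV[R]_n) : Prop :=
  (distances A #<= `I_s)%card.

(* [msize F] is the total degree plus one for F != 0. *)
Definition total_degree (R : realType) (n : nat) (F : {mpoly R[n]}) : nat :=
  (msize F).-1.

Definition vanishes_on (R : realType) (n : nat) (F : {mpoly R[n]})
    (A : set 'rV[R]_n) : Prop :=
  forall p : 'rV[R]_n, A p -> F.@[fun i => p ord0 i] = 0.

(* Main.v *)
Require Import Defs.
From mathcomp Require Import all_boot all_order all_algebra.
From mathcomp Require Import boolp classical_sets functions cardinality reals.
From mathcomp Require Import finmap mpoly zify ring.

(* Let [c] be the product of the squared nonzero distances.  The matrix with
   entries [\prod_t (t - |p_i - p_j|^2)], over the squared distances [t], is
   [c] times the identity on any finite family of points of [A].  If a vector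
   [u] annihilates the values at the [p_i] of all polynomials of degree at most
   [s], then this quadratic form vanishes at [u], as the entries have total
   degree at most [2 s]; hence [u = 0].  So the number of points is at most the
   dimension of the space of polynomials of degree at most [s] restricted to
   the points, and the multiples of [F] by polynomials of degree at most
   [s - d] lie in the kernel of the restriction. *)

Set Implicit Arguments.
Unset Strict Implicit.
Unset Printing Implicit Defensive.

Import Order.TTheory GRing.Theory Num.Theory.

Local Open Scope classical_set_scope.
Local Open Scope ring_scope.

(** Exponent vectors of degree at most [s] correspond to [n]-tuples over ['I_s.+1] with sum at most
    [s], whose number is known. *)
Lemma card_bmultinom (n s : nat) : #|{: 'X_{1..n < s.+1}}| = 'C(n + s, n).
Proof.
pose f (m : 'X_{1..n < s.+1}) : n.-tuple 'I_s.+1 := [tuple inord (m i) | i < n].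
have fE m i : tnth (f m) i = m i :> nat.
  rewrite tnth_mktuple inordK// (leq_ltn_trans _ (bmdeg m))// mdegE.
  by rewrite (bigD1 i)//= leq_addr.
have f_inj : injective f.
  move=> m1 m2 eqf; apply/val_inj/mnmP => i.
  by rewrite -!fE eqf.
rewrite -card_partial_ord_partitions -(fintype.card_image f_inj).
apply: eq_card => t; rewrite !inE; apply/fintype.imageP/idP => [[m _ ->]|le_ts].
  rewrite big_tuple (eq_bigr (fun i => m i)) => [|i _]; last exact: fE.
  by rewrite -mdegE -ltnS bmdeg.
have degt : (mdeg [multinom val (tnth t i) | i < n] < s.+1)%N.
  rewrite mdegE ltnS; apply: leq_trans le_ts; rewrite big_tuple.
  by apply: leq_sum => i _; rewrite mnmE.
exists (BMultinom degt) => //; apply: eq_from_tnth => i; apply/val_inj.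
by rewrite [RHS]fE /= mnmE.
Qed.

Lemma card_le_ordP (T : Type) (A : set T) (N : nat) :
  (forall m (f : 'I_m -> T),
    injective f -> (forall i, A (f i)) -> (m <= N)%N) ->
  (A #<= `I_N)%card.
Proof.
move=> bound.
suff small m : (`I_m #<= A)%card -> (m <= N)%N.
  have [/finite_setP[m Am]|/infiniteP Ainf] := pselect (finite_set A).
    by rewrite (card_le_eql Am) card_le_II small// (card_le_eqr Am).
  (* An infinite set would contain [N.+1] distinct points. *)
  by have := small N.+1 (card_le_trans (card_leT _) Ainf); rewrite ltnn.
move=> /card_leP[f].
have in_I (i : 'I_m) : (i : nat) \in `I_m := mem_set (ltn_ord i).
pose g (i : 'I_m) := val (f (SigSub (in_I i))).
apply: (bound m g) => [i j gij|i]; last exact: set_valP.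
have /(congr1 val)/= := 'inj_f (in_setT (SigSub (in_I i)))
  (in_setT (SigSub (in_I j))) (val_inj gij).
exact: val_inj.
Qed.

Section FewDistances.
Variables (n m : nat).

Section Annihilation.
Variables (R : idomainType) (p : 'I_m -> 'I_n -> R) (u : 'I_m -> R).

Definition sqdist (x y : 'I_n -> R) : R := \sum_(k < n) (x k - y k) ^+ 2.

Let moment (g : {mpoly R[n]}) := \sum_i u i * g.@[p i].

(* Croot-Lev-Pach: a term [g(x) h(y)] of degree at most [2 s] has a factor of
   degree at most [s], which [u] annihilates. *)
Lemma quadratic_form_eq0 (s : nat) (ts : seq R) (g h : {mpoly R[n]}) :
  (forall q : {mpoly R[n]}, (msize q <= s.+1)%N -> moment q = 0) ->
  (msize g + msize h + (size ts).*2 <= s.+1.*2)%N ->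
  \sum_i \sum_j u i * u j *
    (g.@[p i] * h.@[p j] * \prod_(t <- ts) (t - sqdist (p i) (p j))) = 0.
Proof.
(* Both [g] and [h] must vary in the induction: expanding one factor of the product multiplies them
   by coordinates. As [msize] is the degree plus one, the size hypothesis bounds the total degree by
   [2 s]. *)
move=> ann; elim: ts g h => [|t ts IH] g h /= le_s.
  have -> : \sum_i \sum_j u i * u j * (g.@[p i] * h.@[p j] *
      \prod_(t <- [::]) (t - sqdist (p i) (p j))) = moment g * moment h.
    rewrite big_distrlr /=; apply: eq_bigr => i _; apply: eq_bigr => j _.
    by rewrite big_nil mulr1 mulrACA.
  have [gs|gs] := leqP (msize g) s.+1; first by rewrite (ann g)// mul0r.
  rewrite (ann h) ?mulr0//; move: le_s gs; lia.
pose Q (a b : {mpoly R[n]}) := \sum_i \sum_j u i * u j *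
  (a.@[p i] * b.@[p j] * \prod_(t <- ts) (t - sqdist (p i) (p j))).
(* Expand the first factor, with [(x_k - y_k)^2 = x_k^2 - 2 x_k y_k + y_k^2]. Each resulting term
   adds at most 2 to the degrees of [g] and [h], which removing [t] from the list makes up for. *)
transitivity (t * Q g h - \sum_(k < n)
   (Q ('X_k * 'X_k * g) h - (Q ('X_k * g) ('X_k * h)) *+ 2
     + Q g ('X_k * 'X_k * h))).
  pose w i j := u i * u j * \prod_(t <- ts) (t - sqdist (p i) (p j)).
  transitivity (\sum_i \sum_j (t * (w i j * (g.@[p i] * h.@[p j])) -
     \sum_(k < n) (w i j * (('X_k * 'X_k * g).@[p i] * h.@[p j]) -
       (w i j * (('X_k * g).@[p i] * ('X_k * h).@[p j])) *+ 2 +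
       w i j * (g.@[p i] * ('X_k * 'X_k * h).@[p j])))).
    apply: eq_bigr => i _; apply: eq_bigr => j _.
    rewrite big_cons /w; set P := \prod_(_ <- _) _.
    transitivity (t * (u i * u j * P * (g.@[p i] * h.@[p j])) -
      sqdist (p i) (p j) * (u i * u j * P * (g.@[p i] * h.@[p j]))).
      by ring.
    congr (_ - _); rewrite mulr_suml; apply: eq_bigr => k _.
    rewrite !mevalM !mevalXU; ring.
  have QE a b : Q a b = \sum_i \sum_j w i j * (a.@[p i] * b.@[p j]).
    apply: eq_bigr => i _; apply: eq_bigr => j _; rewrite /w; ring.
  under eq_bigr => i _ do rewrite sumrB -mulr_sumr exchange_big /=.
  rewrite sumrB -mulr_sumr [X in _ - X]exchange_big /= QE; congr (_ - _).
  apply: eq_bigr => k _; rewrite !QE.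
  under eq_bigr => i _ do rewrite big_split sumrB sumrMnl /=.
  by rewrite big_split sumrB sumrMnl.
(* Only an inequality, since [msize 0 = 0]. *)
have sX k (q : {mpoly R[n]}) : (msize ('X_k * q) <= (msize q).+1)%N.
  have [->|q0] := eqVneq q 0; first by rewrite mulr0 msize0.
  rewrite msizeM ?msizeX ?mdeg1//.
  by rewrite -msize_poly_eq0 msizeX.
rewrite [Q g h]IH; last by lia.
rewrite mulr0 sub0r big1 ?oppr0// => k _.
have := (sX k g, sX k h, sX k ('X_k * g), sX k ('X_k * h)).
rewrite -!mulrA => -[[[sg sh] sgg] shh].
by rewrite /Q !IH ?mul0rn ?subr0 ?addr0//; lia.
Qed.

End Annihilation.

Variables (R : realFieldType) (p : 'I_m -> 'I_n -> R).

(** The degree bound is strict: [evalmx s.+1] covers the monomials of degree at most [s]. *)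
Definition evalmx (s : nat) : 'M[R]_(m, #|{: 'X_{1..n < s}}|) :=
  \matrix_(i, j) 'X_[(enum_val j : 'X_{1..n < s})].@[p i].

Lemma row_free_evalmx (s : nat) (ts : seq R) :
  (size ts <= s)%N -> 0 \notin ts ->
  (forall i j, i != j -> sqdist (p i) (p j) \in ts) ->
  row_free (evalmx s.+1).
Proof.
move=> ts_s ts0 dist_ts; apply: inj_row_free => v vE0.
(* A linear relation [v] between the rows annihilates each monomial of degree at most [s], hence by
   linearity each such polynomial. *)
have ann (q : {mpoly R[n]}) : (msize q <= s.+1)%N ->
    \sum_i v 0 i * q.@[p i] = 0.
  move=> /mpolywE ->.
  under eq_bigr => i _ do rewrite raddf_sum /= mulr_sumr.
  rewrite exchange_big /= big1// => b _.
  have /rowP/(_ (enum_rank b)) := vE0; rewrite !mxE => vb.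
  transitivity (q@_b * \sum_i v 0 i * evalmx s.+1 i (enum_rank b)).
    2: by rewrite vb mulr0.
  rewrite mulr_sumr; apply: eq_bigr => i _.
  by rewrite mevalZ mxE enum_rankK mulrCA.
have := quadratic_form_eq0 (ts := ts) (g := 1) (h := 1) ann.
have le_2s : (1 + 1 + (size ts).*2 <= s.+1.*2)%N by lia.
rewrite msize1 => /(_ le_2s).
pose c := \prod_(t <- ts) t.
have c0 : c != 0.
  by rewrite prodf_seq_neq0; apply/allP => t tts; apply: contraNneq ts0 => <-.
(* Off the diagonal some factor vanishes, and on it the product is [c], so the form is [c] times the
   sum of the squares of the entries of [v]. *)
under eq_bigr => i _.
  rewrite (bigD1 i)//= [X in _ + X]big1 => [|j ji]; last first.
    rewrite (big_rem (sqdist (p i) (p j))) /= ?dist_ts 1?eq_sym//.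
    by rewrite subrr mul0r !mulr0.
  have -> : sqdist (p i) (p i) = 0.
    by rewrite /sqdist big1// => k _; rewrite subrr expr0n.
  under [\prod_(t <- _) _]eq_bigr => t _ do rewrite subr0.
  rewrite addr0 !meval1 !mul1r -expr2 -/c.
  over.
rewrite -mulr_suml => /eqP; rewrite mulf_eq0 (negPf c0) orbF psumr_eq0.
  2: by move=> i _; exact: sqr_ge0.
move=> /allP v0; apply/rowP => i.
by have := v0 i (mem_index_enum _); rewrite sqrf_eq0 mxE => /eqP.
Qed.

Lemma rank_evalmx_le (F : {mpoly R[n]}) (d s : nat) :
  msize F = d.+1 -> (d <= s)%N -> (forall i, F.@[p i] = 0) ->
  (\rank (evalmx s.+1) <= 'C(n + s, n) - 'C(n + s - d, n))%N.
Proof.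
move=> Fd d_s Fp.
have F0 : F != 0 by rewrite -msize_poly_eq0 Fd.
have szF a : (msize (F * 'X_[a]) = d + (mdeg a).+1)%N.
  by rewrite msizeM ?msizeX ?Fd// -msize_poly_eq0 msizeX.
(* The rows of [W] are the coefficient vectors of the multiples of [F] by monomials of degree at
   most [s - d]. *)
pose W : 'M[R]_(#|{: 'X_{1..n < (s - d).+1}}|, #|{: 'X_{1..n < s.+1}}|) :=
  \matrix_(k, j) (F * 'X_[(enum_val k : 'X_{1..n < (s - d).+1})])@_
    (enum_val j : 'X_{1..n < s.+1}).
have szFb (b : 'X_{1..n < (s - d).+1}) : (msize (F * 'X_[b]) <= s.+1)%N.
  rewrite szF; have := bmdeg b; lia.
have WE : W *m (evalmx s.+1)^T = 0.
  apply/matrixP => k i; rewrite !mxE.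
  transitivity ((F * 'X_[enum_val k]).@[p i]); last by rewrite mevalM Fp mul0r.
  rewrite [in RHS](mpolywE (szFb (enum_val k))) raddf_sum /=.
  rewrite [RHS](reindex (@enum_val 'X_{1..n < s.+1} predT)) /=; last first.
    exact/onW_bij/enum_val_bij.
  by apply: eq_bigr => j _; rewrite mevalZ !mxE.
(* A relation between the rows yields [F * q = 0], and polynomials over a field have no zero
   divisors. *)
have freeW : row_free W.
  apply: inj_row_free => v vW.
  pose q : {mpoly R[n]} := \sum_k v 0 k *: 'X_[enum_val k].
  have FqE : F * q = \sum_k v 0 k *: (F * 'X_[enum_val k]).
    by rewrite mulr_sumr; apply: eq_bigr => k _; rewrite scalerAr.
  have Fq0 : F * q = 0.
    apply/mpolyP => a; rewrite mcoeff0 FqE raddf_sum /=.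
    have [as_|as_] := ltnP (mdeg a) s.+1; last first.
      rewrite big1// => k _; rewrite mcoeffZ.
      rewrite [X in _ * X](_ : _ = 0) ?mulr0//.
      by apply/eqP; rewrite mcoeff_eq0 msize_mdeg_ge// (leq_trans (szFb _)).
    have /rowP/(_ (enum_rank (BMultinom as_))) := vW; rewrite !mxE => vWa.
    rewrite -[RHS]vWa.
    by apply: eq_bigr => k _; rewrite mcoeffZ mxE enum_rankK.
  have q0 : q = 0 by apply/eqP; move/eqP: Fq0; rewrite mulf_eq0 (negPf F0).
  apply/rowP => k; rewrite mxE.
  have := congr1 (mcoeff (enum_val k)) q0.
  rewrite mcoeff0 raddf_sum /= (bigD1 k)//= big1 => [|l lk].
    by rewrite mcoeffZ mcoeffX eqxx mulr1 addr0.
  rewrite mcoeffZ mcoeffX (inj_eq val_inj) (inj_eq enum_val_inj) (negPf lk).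
  by rewrite mulr0.
(* The independent rows of [W] lie in the kernel of evaluation, so the two ranks add up to at most
   the number of monomials. *)
have le_C : ('C(n + s - d, n) + \rank (evalmx s.+1) <= 'C(n + s, n))%N.
  have := mulmx0_rank_max WE.
  rewrite mxrank_tr (eqP freeW) card_bmultinom addnBA//.
  by rewrite -(card_bmultinom n s).
by rewrite leq_subRL// (leq_trans (leq_addr _ _) le_C).
Qed.

End FewDistances.

Theorem corollary1p4 (R : realType) (n : nat) (hn : (1 <= n)%N)
    (F : {mpoly R[n]}) (hF : F != 0) (d : nat) (hd : total_degree F = d)
    (s : nat) (hs : (d <= s)%N)
    (A : set 'rV[R]_n) (hA : s_distance_set s A) (hFA : vanishes_on F A) :
  (A #<= `I_('C(n + s, n) - 'C(n + s - d, n))%N)%card.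
Proof.
apply: card_le_ordP => m f f_inj Af.
pose p i k := f i ord0 k.
have distE i j : edist (f i) (f j) ^+ 2 = sqdist (p i) (p j).
  by rewrite sqr_sqrtr// sumr_ge0// => k _; rewrite sqr_ge0.
have dist0 i j : sqdist (p i) (p j) = 0 -> i = j.
  move/eqP; rewrite psumr_eq0 => [/allP eqp|k _]; last exact: sqr_ge0.
  apply/f_inj/rowP => k; apply/eqP; rewrite -subr_eq0 -sqrf_eq0.
  exact: eqp (mem_index_enum _).
pose D := fset_set (distances A).
(* Filtering out 0 makes [ts0] immediate; [dist0] shows that no distance between distinct points is
   lost. *)
pose ts := [seq r ^+ 2 | r <- enum_fset D & r != 0].
have finD : finite_set (distances A) := card_le_finite hA (finite_II s).
have ts_s : (size ts <= s)%N.
  rewrite size_map size_filter (leq_trans (count_size _ _))//.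
  exact: geq_card_fset_set.
have ts0 : 0 \notin ts.
  apply/mapP => -[r]; rewrite mem_filter => /andP[r0 _] /esym/eqP.
  by rewrite sqrf_eq0 (negPf r0).
have tsP i j : i != j -> sqdist (p i) (p j) \in ts.
  move=> ij; rewrite -distE; apply: map_f; rewrite mem_filter.
  apply/andP; split.
    by apply: contra_neq ij => d0; apply: dist0; rewrite -distE d0 expr0n.
  rewrite in_fset_set//; apply/mem_set; exists (f i), (f j); split=> //.
  by move/f_inj => /eqP; apply/negP.
have Fd : msize F = d.+1.
  by rewrite -hd prednK// lt0n msize_poly_eq0.
(* Row freeness identifies the number [m] of points with the rank of the evaluation matrix. *)
rewrite -(eqP (row_free_evalmx ts_s ts0 tsP)).
by apply: rank_evalmx_le Fd hs _ => i; apply: hFA.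
Qed.
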